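(* Let $\mathbb{P}$ be generated by a PLSEM and let $F\in\mathcal{F}(\mathbb{P})$. Then there exists a set $\mathcal{O}\subseteq\{O\in\mathbb{R}^{p\times p}: OO^t=\mathrm{Id}\}$ of constant orthogonal matrices such that $\mathcal{F}(\mathbb{P})=\{x\mapsto O\,F(x):\ O\in\mathcal{O}\}$.
   Context: A PLSEM with DAG $D$ on $\{1,\dots,p\}$ is a system $X_j=\mu_j+\sum_{i\in\mathrm{pa}_D(j)} f_{j,i}(X_i)+\varepsilon_j$, $j=1,\dots,p$, where $\mu_j\in\mathbb{R}$, $f_{j,i}\in C^2(\mathbb{R})$, $f_{j,i}\not\equiv 0$, $\mathbb{E}[f_{j,i}(X_i)]=0$, and $\varepsilon_1,\dots,\varepsilon_p$ are mutually independent with $\varepsilon_j\sim\mathcal{N}(0,\sigma_j^2)$, $\sigma_j^2>0$; the distribution of the solution $X$ is said to be generated by the PLSEM. The PLSEM-function of such a PLSEM is $F:\mathbb{R}^p\to\mathbb{R}^p$, $F(x)_j=\frac{1}{\sigma_j}\big(x_j-\mu_j-\sum_{i\in\mathrm{pa}_D(j)}f_{j,i}(x_i)\big)$. $\mathcal{F}(\mathbb{P})$ denotes the set of PLSEM-functions of all PLSEMs that generate $\mathbb{P}$. *)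

(* Defs.v *)
From HB Require Import structures.
From mathcomp Require Import all_boot all_order all_algebra.
From mathcomp Require Import all_classical all_reals all_analysis.
Set Implicit Arguments. Unset Strict Implicit. Unset Printing Implicit Defensive.
Import Order.TTheory GRing.Theory Num.Theory.
Import numFieldNormedType.Exports.
Local Open Scope classical_set_scope.
Local Open Scope ring_scope.

(* A directed graph on {0,...,p-1} is given by an edge relation E,
   with [E i j] meaning i -> j, i.e. i is a parent of j.  It is a DAG
   iff it has no directed cycle: no edge i -> j with a path back j ~> i
   (this also excludes self loops since [connect] is reflexive). *)
Definition is_dag (p : nat) (E : rel 'I_p) : Prop :=
  forall i j : 'I_p, E i j -> ~~ connect E j i.

Definition C2 (R : realType) (f : R -> R) : Prop :=
  (forall x : R, derivable f x 1) /\
  (forall x : R, derivable (derive1 f) x 1) /\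
  continuous (derive1 (derive1 f)).

(* Data of a PLSEM on p variables (indices 0..p-1):
   X_j = mu_j + sum_{i in pa(j)} f_{j,i}(X_i) + eps_j,  eps_j ~ N(0, sigma_j^2). *)
Record plsem (R : realType) (p : nat) := Plsem {
  pl_edge : rel 'I_p;               (* pl_edge i j : i is a parent of j *)
  pl_mu : 'I_p -> R;
  pl_f : 'I_p -> 'I_p -> R -> R;    (* pl_f j i = f_{j,i} *)
  pl_sigma : 'I_p -> R
}.

Definition plsem_wf (R : realType) (p : nat) (M : plsem R p) : Prop :=
  is_dag (pl_edge M) /\
  (forall j : 'I_p, 0 < pl_sigma M j) /\
  (forall i j : 'I_p, pl_edge M i j ->
      C2 (pl_f M j i) /\ exists x : R, pl_f M j i x != 0).

Definition mutually_independent (R : realType) (d : measure_display)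
  (Omega : measurableType d) (Pr : probability Omega R) (p : nat)
  (Y : 'I_p -> Omega -> R) : Prop :=
  forall B : 'I_p -> set R, (forall j, measurable (B j)) ->
    Pr (\bigcap_(j in [set: 'I_p]) (Y j @^-1` B j)) =
    (\prod_(j < p) Pr (Y j @^-1` B j))%E.

Definition generates (R : realType) (p : nat) (M : plsem R p)
  (P : probability (p.-tuple R) R) : Prop :=
  plsem_wf M /\
  exists (d : measure_display) (Omega : measurableType d)
         (Pr : probability Omega R) (eps X : 'I_p -> Omega -> R),
    (forall j, measurable_fun setT (eps j)) /\
    (forall j (B : set R), measurable B ->
        Pr (eps j @^-1` B) = normal_prob 0 (pl_sigma M j) B) /\
    mutually_independent Pr eps /\
    (forall j, measurable_fun setT (X j)) /\
    (forall j w, X j w = pl_mu M j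
        + \sum_(i < p | pl_edge M i j) pl_f M j i (X i w) + eps j w) /\
    (forall i j, pl_edge M i j ->
        Pr.-integrable setT (fun w => (pl_f M j i (X i w))%:E) /\
        (\int[Pr]_w (pl_f M j i (X i w))%:E = 0)%E) /\
    (forall A : set (p.-tuple R), measurable A ->
        P A = Pr ((fun w => [tuple X i w | i < p]) @^-1` A)).

Definition plsem_fun (R : realType) (p : nat) (M : plsem R p)
  (x : 'cV[R]_p) : 'cV[R]_p :=
  \col_(j < p) ((pl_sigma M j)^-1 *
     (x j ord0 - pl_mu M j
      - \sum_(i < p | pl_edge M i j) pl_f M j i (x i ord0))).

Definition plsem_funs (R : realType) (p : nat)
  (P : probability (p.-tuple R) R) : set ('cV[R]_p -> 'cV[R]_p) :=
  [set F | exists M : plsem R p, generates M P /\ F = plsem_fun M].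

(* Main.v *)
Require Import Defs.
From HB Require Import structures.
From mathcomp Require Import all_boot all_order all_algebra.
From mathcomp Require Import all_classical all_reals all_analysis.
From mathcomp Require Import measurable_realfun ring lra.
Set Implicit Arguments.
Unset Strict Implicit.
Unset Printing Implicit Defensive.
Import Order.TTheory GRing.Theory Num.Theory.
Import numFieldNormedType.Exports.
Local Open Scope classical_set_scope.
Local Open Scope ring_scope.

(** Let [F] and [G] be PLSEM-functions of the same distribution.  The structural
    equations are triangular, so the distribution has at [x] a density
    proportional to [exp (- |F x|^2 / 2)], and likewise for [G].  Comparing the
    two and using that [F] and [G] both vanish somewhere, [|F x| = |G x|] for
    all [x].  This uses no change of variables: the probability of a box of
    half-width [h] around [x] is squeezed between products of normal densities,
    conditioning on one coordinate at a time, and [h] tends to 0.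

    At a common zero [a], write [F x = sum_k U_k (x_k)] and
    [G x = sum_k V_k (x_k)] with [U_k], [V_k] vanishing at [a_k].  Equality of
    norms gives [<U_k t, U_l s> = <V_k t, V_l s>] for [k != l] and
    [|U_k t| = |V_k t|]; by differentiation at [a] the Jacobians [A], [B] of
    [F], [G] satisfy [A^T A = B^T B], so [O := B A^-1] is orthogonal.  Then
    [V_k t - O U_k t] is a multiple of the [k]-th row of [B^-1].  Acyclicity
    makes the [k]-th entries of [A^-1 U_k t] and [B^-1 V_k t] both equal to
    [t - a_k], which forces this multiple to be 0. *)

(** * Ranks on a DAG and solutions of the structural equations *)

(** The rank counts ancestors, the node itself included. Along an edge from [i] to [j] it grows
    strictly, because [j] is its own ancestor but, by acyclicity, not one of [i]. *)
Lemma dag_rank (p : nat) (E : rel 'I_p) : is_dag E ->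
  exists2 r : 'I_p -> nat, (forall i j, E i j -> (r i < r j)%N)
    & (forall i, (r i <= p)%N).
Proof.
move=> dagE; exists (fun j => #|[pred i | connect E i j]|).
  move=> i j Eij; apply/proper_card/properP; split.
    apply/fintype.subsetP => k; rewrite !inE => ki.
    exact: connect_trans ki (connect1 Eij).
  exists j; first by rewrite inE connect0.
  by rewrite inE; exact: dagE.
by move=> i; rewrite -[leqRHS]card_ord; exact: max_card.
Qed.

(* The iteration is stationary at a node after more steps than its rank. *)
Fixpoint plsem_iter (R : realType) (p : nat) (M : plsem R p) (n : nat)
    (e : 'I_p -> R) (j : 'I_p) : R :=
  if n is n'.+1 then pl_mu M j
    + \sum_(i < p | pl_edge M i j) pl_f M j i (plsem_iter M n' e i) + e j
  else 0.

(** Ranks are at most [p], so after [p.+1] steps every node has become stationary. *)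
Definition plsem_sol (R : realType) (p : nat) (M : plsem R p) :=
  plsem_iter M p.+1.

Section Sol.
Variables (R : realType) (p : nat) (M : plsem R p).
Hypothesis dagM : is_dag (pl_edge M).

Lemma plsem_solE (e : 'I_p -> R) (j : 'I_p) :
  plsem_sol M e j = pl_mu M j
    + \sum_(i < p | pl_edge M i j) pl_f M j i (plsem_sol M e i) + e j.
Proof.
have [r rE rp] := dag_rank dagM.
have stab n : forall k, (r k < n)%N ->
    plsem_iter M n.+1 e k = plsem_iter M n e k.
  elim: n => // n IH k rk /=; congr (_ + _ + _).
  apply: eq_bigr => i Eik; congr (pl_f M k i _).
  by apply: IH; apply: leq_trans (rE _ _ Eik) _.
by rewrite /plsem_sol -stab ?ltnS ?rp.
Qed.

(** The equations at the nodes of an ancestral set form a closed system, which determines [x] there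
    by induction on the rank. The noise outside [S] may thus be changed freely. *)
Lemma plsem_sol_unique (S : {set 'I_p}) (e x : 'I_p -> R) :
  (forall i j, pl_edge M i j -> j \in S -> i \in S) ->
  (forall j, j \in S -> x j = pl_mu M j
    + \sum_(i < p | pl_edge M i j) pl_f M j i (x i) + e j) ->
  forall j, j \in S -> x j = plsem_sol M e j.
Proof.
move=> anc xE; have [r rE _] := dag_rank dagM.
suff H n : forall j, (r j < n)%N -> j \in S -> x j = plsem_sol M e j.
  by move=> j; exact: (H (r j).+1).
elim: n => // n IH j rj jS; rewrite xE// plsem_solE; congr (_ + _ + _).
apply: eq_bigr => i Eij; congr (pl_f M j i _).
by apply: IH; [exact: leq_trans (rE _ _ Eij) _|exact: anc Eij _].
Qed.
End Sol.

(** * Rigidity of additive maps *)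

Section AdditiveRigidity.
Variables (R : realType) (p : nat) (U V : 'I_p -> 'I_p -> R -> R)
  (A B : 'M[R]_p) (a : 'I_p -> R).
Hypotheses (U0 : forall j k, U j k (a k) = 0)
  (V0 : forall j k, V j k (a k) = 0).
Hypothesis UA : forall j k, h^-1 * U j k (a k + h) @[h --> 0^'] --> A j k.
Hypothesis VB : forall j k, h^-1 * V j k (a k + h) @[h --> 0^'] --> B j k.
Hypothesis normUV : forall x : 'I_p -> R,
  \sum_j (\sum_k U j k (x k)) ^+ 2 = \sum_j (\sum_k V j k (x k)) ^+ 2.

Lemma additive_norm_eq (k : 'I_p) (t : R) :
  \sum_j U j k t ^+ 2 = \sum_j V j k t ^+ 2.
Proof.
have E (W : 'I_p -> 'I_p -> R -> R) j : (forall j k, W j k (a k) = 0) ->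
    \sum_l W j l (if l == k then t else a l) = W j k t.
  move=> W0; rewrite (bigD1 k)//= eqxx big1 ?addr0// => l /negbTE ->.
  exact: W0.
have := normUV (fun l => if l == k then t else a l).
by under eq_bigr do rewrite E//; under [X in _ = X -> _]eq_bigr do rewrite E//.
Qed.

(** Polarization: move the coordinates [k] and [l] of the base point at once; the pure squares
    cancel by [additive_norm_eq] and twice the cross terms remain. *)
Lemma additive_gram_eq (k l : 'I_p) (t s : R) : k != l ->
  \sum_j U j k t * U j l s = \sum_j V j k t * V j l s.
Proof.
move=> kl.
have E (W : 'I_p -> 'I_p -> R -> R) j : (forall j k, W j k (a k) = 0) ->
    \sum_i W j i (if i == k then t else if i == l then s else a i)
    = W j k t + W j l s.
  move=> W0; rewrite (bigD1 k)//= eqxx (bigD1 l) 1?eq_sym//=.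
  rewrite (negbTE kl) eqxx big1 ?addr0// => i /andP[/negbTE -> /negbTE ->].
  exact: W0.
have := normUV (fun i => if i == k then t else if i == l then s else a i).
under eq_bigr do rewrite E// sqrrD.
under [X in _ = X -> _]eq_bigr do rewrite E// sqrrD.
rewrite !big_split/= !additive_norm_eq
  -!mulr2n => /addIr /addrI.
by move=> /eqP; rewrite eqrMn2r// => /eqP.
Qed.

Lemma cvg_sumr (T : Type) (F : set_system T) (FF : Filter F)
    (f : 'I_p -> T -> R) (l : 'I_p -> R) :
  (forall j, f j x @[x --> F] --> l j) ->
  \sum_j f j x @[x --> F] --> \sum_j l j.
Proof. by move=> fl; apply: cvg_big => // x; exact: add_continuous. Qed.

(** Divide the identity of [additive_gram_eq] by the increment of the [k]-th coordinate and pass to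
    the limit. *)
Lemma additive_jacobian_column (k l : 'I_p) (s : R) : k != l ->
  \sum_j A j k * U j l s = \sum_j B j k * V j l s.
Proof.
move=> kl.
have cU : \sum_j (h^-1 * U j k (a k + h)) * U j l s @[h --> 0^'] -->
    \sum_j A j k * U j l s.
  by apply: cvg_sumr => j; apply: cvgMl; exact: UA.
have cV : \sum_j (h^-1 * V j k (a k + h)) * V j l s @[h --> 0^'] -->
    \sum_j B j k * V j l s.
  by apply: cvg_sumr => j; apply: cvgMl; exact: VB.
apply: (cvg_unique _ cU) => //; apply: cvg_trans cV.
apply: near_eq_cvg; near=> h.
under eq_bigr do rewrite -mulrA; under [RHS]eq_bigr do rewrite -mulrA.
by rewrite -!mulr_sumr additive_gram_eq.
Unshelve. all: by end_near.
Qed.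

(** Diagonal entries are limits of the equality of norms divided by [h ^+ 2]; off-diagonal ones come
    from differentiating [additive_jacobian_column] in its second coordinate. *)
Lemma additive_jacobian_gram : A^T *m A = B^T *m B.
Proof.
apply/matrixP => k l; rewrite !mxE.
under eq_bigr do rewrite mxE; under [RHS]eq_bigr do rewrite mxE.
have [<-{l}|kl] := eqVneq k l.
  have cU : \sum_j (h^-1 * U j k (a k + h)) * (h^-1 * U j k (a k + h))
      @[h --> 0^'] --> \sum_j A j k * A j k.
    by apply: cvg_sumr => j; apply: cvgM; exact: UA.
  have cV : \sum_j (h^-1 * V j k (a k + h)) * (h^-1 * V j k (a k + h))
      @[h --> 0^'] --> \sum_j B j k * B j k.
    by apply: cvg_sumr => j; apply: cvgM; exact: VB.
  apply: (cvg_unique _ cU) => //; apply: cvg_trans cV.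
  apply: near_eq_cvg; near=> h.
  under eq_bigr do rewrite mulrACA; under [RHS]eq_bigr do rewrite mulrACA.
  by rewrite -!mulr_sumr additive_norm_eq.
have cU : \sum_j A j k * (h^-1 * U j l (a l + h)) @[h --> 0^'] -->
    \sum_j A j k * A j l.
  by apply: cvg_sumr => j; apply: cvgMr; exact: UA.
have cV : \sum_j B j k * (h^-1 * V j l (a l + h)) @[h --> 0^'] -->
    \sum_j B j k * B j l.
  by apply: cvg_sumr => j; apply: cvgMr; exact: VB.
apply: (cvg_unique _ cU) => //; apply: cvg_trans cV.
apply: near_eq_cvg; near=> h.
under eq_bigr do rewrite mulrCA; under [RHS]eq_bigr do rewrite mulrCA.
by rewrite -!mulr_sumr additive_jacobian_column.
Unshelve. all: by end_near.
Qed.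

Hypotheses (unitA : A \in unitmx) (unitB : B \in unitmx).
Hypothesis diagU : forall k t, \sum_j invmx A k j * U j k t = t - a k.
Hypothesis diagV : forall k t, \sum_j invmx B k j * V j k t = t - a k.

(* With O := B A^-1, the vector B^T (V_k - O U_k) is a multiple d of the k-th
   basis vector, so V_k - O U_k = d w with w the k-th row of B^-1.  As both V_k
   and O U_k have inner product t - a k with w, d |w|^2 = 0. *)
Lemma additive_rigidity : exists2 O : 'M[R]_p, O *m O^T = 1%:M
  & forall k t, \col_j V j k t = O *m \col_j U j k t.
Proof.
have gramAB := additive_jacobian_gram.
exists (B *m invmx A) => [|k t].
  apply: mulmx1C; rewrite trmx_mul -mulmxA (mulmxA _ B) -gramAB.
  rewrite !mulmxA trmx_inv mulVmx ?unitmx_tr// mul1mx mulmxV//.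
set v := \col_j V j k t; set u := \col_j U j k t.
pose D := v - B *m invmx A *m u.
have BD : B^T *m D = (B^T *m D) k 0 *: delta_mx k 0.
  apply/matrixP => l z; rewrite [z]ord1 [RHS]mxE mxE.
  rewrite [X in _ = _ * X]mxE eqxx andbT.
  have [->|lk] := eqVneq l k; first by rewrite mulr1 mxE.
  rewrite mulr0; transitivity ((B^T *m D) l 0); first by rewrite mxE.
  rewrite /D mulmxBr !mulmxA -gramAB -(mulmxA _ A) mulmxV// mulmx1.
  rewrite !mxE; apply/eqP; rewrite subr_eq0; apply/eqP; symmetry.
  under eq_bigr do rewrite !mxE; under [RHS]eq_bigr do rewrite !mxE.
  exact: additive_jacobian_column.
set d := _ k 0 in BD.
have DE : D = d *: (invmx B)^T *m delta_mx k 0.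
  by rewrite -scalemxAl scalemxAr -BD mulmxA trmx_inv mulVmx ?unitmx_tr//
    mul1mx.
pose w := row k (invmx B).
have wD : (w *m D) 0 0 = 0.
  rewrite /D mulmxBr mxE [X in _ + X]mxE.
  have -> : w *m (B *m invmx A *m u) = row k (invmx A *m u).
    by rewrite -row_mul !mulmxA mulVmx// mul1mx.
  rewrite -row_mul !mxE; under eq_bigr do rewrite !mxE.
  under [X in _ - X]eq_bigr do rewrite !mxE.
  by rewrite diagV diagU subrr.
have DwT : D = d *: w^T.
  by rewrite DE -scalemxAl -colE tr_row.
have ww : \sum_j w 0 j ^+ 2 != 0.
  apply/negP => /eqP /psumr_eq0P w0.
  have {}w0 : w = 0.
    apply/rowP => j; rewrite [RHS]mxE; apply/eqP.
    by rewrite -sqrf_eq0 w0// => i _; exact: sqr_ge0.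
  have : w *m B = delta_mx 0 k.
    by rewrite -row_mul mulVmx// rowE mulmx1.
  rewrite w0 mul0mx => /matrixP/(_ 0 k); rewrite !mxE !eqxx.
  by move/eqP; rewrite eq_sym oner_eq0.
have d0 : d = 0.
  move: wD; rewrite DwT -scalemxAr mxE mxE.
  under eq_bigr do rewrite [X in _ * X]mxE -expr2.
  by move=> /eqP; rewrite mulf_eq0 (negbTE ww) orbF => /eqP.
by apply/eqP; rewrite -subr_eq0 -/D DwT d0 scale0r.
Qed.

End AdditiveRigidity.

(** * Jacobians of PLSEM-functions *)

(** This is what the [k]-th coordinate contributes to the [j]-th component of the PLSEM-function,
    normalized to vanish at [a k]. A boolean multiplicity switches a term off. *)
Definition plsem_part (R : realType) (p : nat) (M : plsem R p) (a : 'I_p -> R)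
    (j k : 'I_p) (t : R) : R :=
  (pl_sigma M j)^-1 * ((t - a k) *+ (j == k)
    - (pl_f M j k t - pl_f M j k (a k)) *+ pl_edge M k j).

Definition plsem_jacobian (R : realType) (p : nat) (M : plsem R p)
    (a : 'I_p -> R) : 'M[R]_p :=
  \matrix_(j, k) ((pl_sigma M j)^-1
    * ((j == k)%:R - derive1 (pl_f M j k) (a k) *+ pl_edge M k j)).

Section PlsemParts.
Variables (R : realType) (p : nat) (M : plsem R p).
Hypothesis wfM : plsem_wf M.
Variable a : 'I_p -> R.

Let dagM : is_dag (pl_edge M). Proof. by case: wfM. Qed.
Let sigma_gt0 j : 0 < pl_sigma M j. Proof. by case: wfM => _ []. Qed.

Lemma plsem_noloop k : pl_edge M k k = false.
Proof. by apply/negP => /dagM; rewrite connect0. Qed.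

Lemma plsem_part0 j k : plsem_part M a j k (a k) = 0.
Proof. by rewrite /plsem_part !subrr !mul0rn subrr mulr0. Qed.

Lemma plsem_funB (x : 'cV[R]_p) j :
  plsem_fun M x j 0 - plsem_fun M (\col_k a k) j 0
  = \sum_k plsem_part M a j k (x k 0).
Proof.
rewrite !mxE -mulrBr -mulr_sumr; congr (_ * _).
rewrite sumrB [X in _ = X - _](bigD1 j)//= eqxx mulr1n.
rewrite [X in _ = _ + X - _]big1 ?addr0; last first.
  by move=> i /negbTE; rewrite eq_sym => ->.
rewrite [X in _ = _ - X](eq_bigr (fun i =>
    (if pl_edge M i j then pl_f M j i (x i 0) else 0)
    - (if pl_edge M i j then pl_f M j i (a i) else 0))); last first.
  by move=> i _; case: ifP; rewrite ?mulr1n// subr0.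
rewrite sumrB -!big_mkcond/=.
under [X in _ - (_ - X)]eq_bigr do rewrite mxE.
by ring.
Qed.

Lemma plsem_part_slope j k :
  h^-1 * plsem_part M a j k (a k + h) @[h --> 0^'] --> plsem_jacobian M a j k.
Proof.
rewrite mxE; set c := (pl_sigma M j)^-1.
have -> : (fun h => h^-1 * plsem_part M a j k (a k + h)) = (fun h : R =>
    c * ((h^-1 * h) *+ (j == k)
      - (h^-1 *: (pl_f M j k (h *: 1 + a k) - pl_f M j k (a k))) *+ pl_edge M k j)).
  apply/funext => h; rewrite /plsem_part -/c mulrCA; congr (_ * _).
  rewrite mulrBr !mulrnAr.
  by rewrite [h *: 1]mulr1 [a k + h]addrC addrK.
apply: cvgMr; apply: cvgB.
  apply: cvgMn; apply: cvg_near_cst; near=> h; rewrite mulVf//.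
  by near: h; exact: nbhs_dnbhs_neq.
have [e|] := boolP (pl_edge M k j); last by move=> _; exact: cvg_cst.
have [_ [_ /(_ _ _ e) [[df _] _]]] := wfM.
apply: cvgMn; rewrite derive1E; exact: df.
Unshelve. all: by end_near.
Qed.

(** Column [l] of the Jacobian is supported on [l] and its children. Once [n] is known to vanish at
    the children, the equation for column [l] leaves only a nonzero multiple of [n l]. *)
Lemma plsem_jacobian_kernel (S : pred 'I_p) (n : 'I_p -> R) :
  (forall l j, pl_edge M l j -> S l -> S j) ->
  (forall l, S l -> \sum_j n j * plsem_jacobian M a j l = 0) ->
  forall l, S l -> n l = 0.
Proof.
move=> Sch n0; have [r rE rp] := dag_rank dagM.
(* The induction runs from high rank to low: for [m = 0] no node qualifies, and each step admits one
   lower rank. *)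
suff H m : forall l, (p < m + r l)%N -> S l -> n l = 0.
  by move=> l; apply: (H p.+1); rewrite addSn ltnS leq_addr.
elim: m => [l|m IH l rl Sl]; first by rewrite add0n ltnNge rp.
have := n0 _ Sl; rewrite (bigD1 l)//= mxE eqxx plsem_noloop subr0 mulr1 big1.
  move=> /eqP; rewrite addr0 mulf_eq0 invr_eq0 (gt_eqF (sigma_gt0 l)) orbF.
  by move/eqP.
move=> j /negbTE jl; rewrite mxE jl sub0r.
case: (boolP (pl_edge M l j)) => [e|_]; last by rewrite mulr0n oppr0 !mulr0.
rewrite IH ?mul0r//; last exact: Sch e Sl.
by rewrite (leq_trans rl)// addSnnS leq_add2l rE.
Qed.

Lemma plsem_jacobian_unit : plsem_jacobian M a \in unitmx.
Proof.
rewrite -row_free_unit; apply: inj_row_free => v vA.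
apply/rowP => l; rewrite [RHS]mxE.
apply: (@plsem_jacobian_kernel xpredT (v 0)) => // k _.
by move/matrixP: vA => /(_ 0 k); rewrite mxE => ->; rewrite mxE.
Qed.

(* The k-th row of the inverse Jacobian vanishes on the descendants of k, which
   are the only components besides k that the k-th part moves. *)
Lemma plsem_part_dual k t :
  \sum_j invmx (plsem_jacobian M a) k j * plsem_part M a j k t = t - a k.
Proof.
set n := invmx _ k; have [r rE rp] := dag_rank dagM.
have nA l : \sum_j n j * plsem_jacobian M a j l = (k == l)%:R.
  have := mulVmx plsem_jacobian_unit => /matrixP/(_ k l).
  by rewrite mxE => ->; rewrite mxE.
(* The nodes of rank above that of [k] are closed under children and exclude [k], so
   [plsem_jacobian_kernel] applies to them. *)
have n0 j : (r k < r j)%N -> n j = 0.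
  apply: (@plsem_jacobian_kernel (fun j => (r k < r j)%N)) => [l i /rE|l kl].
    by move=> li kl; exact: ltn_trans kl li.
  by rewrite nA; case: eqVneq kl => // ->; rewrite ltnn.
have off (g : 'I_p -> R) : \sum_(j | j != k) n j * ((pl_sigma M j)^-1
    * ((j == k)%:R * g j - g j *+ pl_edge M k j)) = 0.
  apply: big1 => j /negbTE ->.
  case: (boolP (pl_edge M k j)) => [/rE/n0 ->|_]; first by rewrite mul0r.
  by rewrite mul0r subr0 !mulr0.
have nk : n k = pl_sigma M k.
  have := nA k; rewrite eqxx (bigD1 k)//= mxE eqxx plsem_noloop subr0 mulr1.
  rewrite big1 ?addr0; last first.
    move=> j /negbTE jk; rewrite mxE jk.
    case: (boolP (pl_edge M k j)) => [/rE/n0 ->|_]; first by rewrite mul0r.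
    by rewrite subr0 !mulr0.
  by move/divr1_eq.
rewrite (bigD1 k)//= big1 ?addr0.
  rewrite /plsem_part nk eqxx plsem_noloop subr0 mulr1n mulrA divff ?mul1r//.
  exact: lt0r_neq0.
move=> j /negbTE jk; rewrite /plsem_part jk.
case: (boolP (pl_edge M k j)) => [/rE/n0 ->|_]; first by rewrite mul0r.
by rewrite subr0 !mulr0.
Qed.

Lemma plsem_fun_zero : exists b : 'I_p -> R, plsem_fun M (\col_k b k) = 0.
Proof.
(* The noise-free solution has zero residuals. *)
exists (plsem_sol M (fun=> 0)); apply/colP => j; rewrite !mxE plsem_solE// addr0.
under [X in _ - X]eq_bigr do rewrite mxE.
by rewrite addrAC addrK subrr mulr0.
Qed.

End PlsemParts.

Lemma plsem_fun_orthogonal (R : realType) (p : nat) (M N : plsem R p) :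
  plsem_wf M -> plsem_wf N ->
  (forall x, \sum_j plsem_fun M x j 0 ^+ 2 = \sum_j plsem_fun N x j 0 ^+ 2) ->
  exists2 O : 'M[R]_p, O *m O^T = 1%:M
    & plsem_fun N = (fun x => O *m plsem_fun M x).
Proof.
move=> wM wN MN; have [a Ma] := plsem_fun_zero wM.
(* A zero of one function is a zero of the other, since the norms agree. *)
have Na : plsem_fun N (\col_k a k) = 0.
  apply/colP => j; rewrite [RHS]mxE; apply/eqP; rewrite -sqrf_eq0.
  have := MN (\col_k a k); rewrite Ma big1 => [|i _]; last by rewrite mxE expr0n.
  by move=> /esym/psumr_eq0P -> // i _; exact: sqr_ge0.
have partE K x : plsem_wf K -> plsem_fun K (\col_k a k) = 0 ->
    forall j, plsem_fun K x j 0 = \sum_k plsem_part K a j k (x k 0).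
  by move=> wK Ka j; rewrite -plsem_funB// Ka [X in _ - X]mxE subr0.
have norm (x : 'I_p -> R) : \sum_j (\sum_k plsem_part M a j k (x k)) ^+ 2
    = \sum_j (\sum_k plsem_part N a j k (x k)) ^+ 2.
  have := MN (\col_k x k).
  under eq_bigr do rewrite (partE _ _ wM Ma).
  under [X in _ = X -> _]eq_bigr do rewrite (partE _ _ wN Na).
  under eq_bigr do under eq_bigr do rewrite mxE.
  by under [X in _ = X -> _]eq_bigr do under eq_bigr do rewrite mxE.
have [Q QQ QV] := additive_rigidity (plsem_part0 M a) (plsem_part0 N a)
  (@plsem_part_slope _ _ M wM a) (@plsem_part_slope _ _ N wN a) norm
  (plsem_jacobian_unit wM a) (plsem_jacobian_unit wN a)
  (plsem_part_dual wM a) (plsem_part_dual wN a).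
exists Q => //; apply/funext => x.
have colE K : plsem_wf K -> plsem_fun K (\col_k a k) = 0 ->
    plsem_fun K x = \sum_k \col_j plsem_part K a j k (x k 0).
  move=> wK Ka; apply/colP => j; rewrite partE// summxE.
  by apply: eq_bigr => k _; rewrite mxE.
by rewrite (colE _ wN Na) (colE _ wM Ma) mulmx_sumr; apply: eq_bigr => k _.
Qed.

(** * Gaussian noise conditioned on an independent variable *)

Lemma normal_prob_itv_bound (R : realType) (s c l lo hi : R) :
  0 <= l -> 0 <= lo ->
  (forall e, c <= e <= c + l -> lo <= normal_pdf 0 s e <= hi) ->
  ((l * lo)%:E <= normal_prob 0 s `[c, (c + l)%R] <= (l * hi)%:E)%E.
Proof.
move=> l0 lo0 H.
have lE (r : R) : (l * r)%:E =
    (\int[lebesgue_measure]_(x in `[c, (c + l)%R]) (cst r%:E x))%E.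
  rewrite integral_cst//= lebesgue_measure_itv/= lte_fin.
  case: ltP => [_|cl]; first by rewrite -EFinB -EFinM mulrC addrAC subrr add0r.
  have -> : l = 0 by lra.
  by rewrite mul0r mule0.
have mpdf : measurable_fun (`[c, (c + l)%R] : set R) (EFin \o normal_pdf 0 s).
  apply/measurable_EFinP; apply: measurable_funTS.
  exact: measurable_normal_pdf.
rewrite /normal_prob !lE; apply/andP; split; apply: ge0_le_integral => //= x.
- by rewrite in_itv/= lee_fin => /H/andP[].
- by rewrite lee_fin normal_pdf_ge0.
- by rewrite in_itv/= lee_fin => /H/andP[].
Qed.

Definition mfun_of d d' (aT : measurableType d) (rT : measurableType d')
    (f : aT -> rT) (mf : measurable_fun setT f) : {mfun aT >-> rT} :=
  HB.pack_for {mfun aT >-> rT} f (isMeasurableFun.Build _ _ _ _ f mf).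

(* The conditional law of [e] given [Y = y] being normal, the probability of the
   event is the integral over [A] of the normal measure of an interval of length
   [2h]; this integral is the product measure evaluated by sections. *)
Lemma normal_conditional_bound (R : realType) d d' (Omega : measurableType d)
    (T : measurableType d') (Pr : probability Omega R) (Y : Omega -> T)
    (e : Omega -> R) (s : R) (m : T -> R) (A : set T) (c h lo hi : R) :
  measurable_fun setT Y -> measurable_fun setT e ->
  (forall B, measurable B -> Pr (e @^-1` B) = normal_prob 0 s B) ->
  (forall C B, measurable C -> measurable B ->
    Pr (Y @^-1` C `&` e @^-1` B) = (Pr (Y @^-1` C) * Pr (e @^-1` B))%E) ->
  measurable_fun setT m -> measurable A -> 0 <= h -> 0 <= lo ->
  (forall y u, A y -> c - h <= m y + u <= c + h ->
    lo <= normal_pdf 0 s u <= hi) ->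
  (Pr (Y @^-1` A) * (h *+ 2 * lo)%:E
     <= Pr [set w | A (Y w) /\ (c - h <= m (Y w) + e w <= c + h)%R]
     <= Pr (Y @^-1` A) * (h *+ 2 * hi)%:E)%E.
Proof.
move=> mY me law indep mm mA h0 lo0 H.
have mYe := measurable_fun_pair mY me.
pose Y' := mfun_of mY; pose e' := mfun_of me; pose Z := mfun_of mYe.
pose C : set (T * R) := [set z | A z.1 /\ c - h <= m z.1 + z.2 <= c + h].
have mC : measurable C.
  have -> : C = (fst @^-1` A) `&`
      ((fun z : T * R => m z.1 + z.2) @^-1` `[c - h, c + h]).
    by apply/seteqP; split => z /=; rewrite in_itv/=.
  apply: measurableI; rewrite -[X in measurable X]setTI.
    exact: measurable_fst.
  by apply: measurable_funD => //; exact: measurableT_comp.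
(* The joint law of [Y] and [e] agrees with the product of their laws on rectangles, hence
   everywhere. *)
have prodE : Pr [set w | A (Y w) /\ c - h <= m (Y w) + e w <= c + h]
    = (distribution Pr Y' \x distribution Pr e')%E C.
  transitivity (distribution Pr Z C); first by [].
  apply/esym; apply: (@product_measure_unique _ _ _ _ _ (distribution Pr Y')
    (distribution Pr e') (distribution Pr Z)) => //.
pose J y : set R := `[c - h - m y, c - h - m y + h *+ 2]%classic.
have sec y : A y -> xsection C y = J y.
  rewrite /J => Ay; apply/seteqP; split => u.
    rewrite /xsection/= inE/= /C/= => -[_]; rewrite in_itv/= => /andP[? ?].
    by apply/andP; split; lra.
  rewrite /xsection/= in_itv/= inE/= /C/= => /andP[? ?]; split => //.
  by apply/andP; split; lra.
have sec0 y : ~ A y -> xsection C y = set0.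
  move=> Ay; apply/seteqP; split => u //.
  by rewrite /xsection/= inE/= /C/= => -[].
have h20 : 0 <= h *+ 2 by rewrite mulrn_wge0.
have bound y : A y -> ((h *+ 2 * lo)%:E <= distribution Pr e' (xsection C y)
    <= (h *+ 2 * hi)%:E)%E.
  move=> Ay; rewrite sec//.
  have -> : distribution Pr e' (J y) = normal_prob 0 s (J y).
    by apply: law; exact: measurable_itv.
  apply: normal_prob_itv_bound => // u /andP[? ?].
  by apply: (H y) => //; apply/andP; split; lra.
have AE (r : R) : 0 <= r -> (Pr (Y @^-1` A) * (h *+ 2 * r)%:E =
    \int[distribution Pr Y']_y ((\1_A y)%:E * (h *+ 2 * r)%:E))%E.
  move=> r0; rewrite ge0_integralZr//; last by rewrite lee_fin mulr_ge0.
    by rewrite integral_indic// setIT.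
  by apply/measurable_EFinP; exact: measurable_indic.
have mind (r : R) :
    measurable_fun setT (fun y => (\1_A y)%:E * (h *+ 2 * r)%:E)%E.
  apply: emeasurable_funM => //.
  by apply/measurable_EFinP; exact: measurable_indic.
have msec : measurable_fun setT (distribution Pr e' \o xsection C).
  exact: measurable_fun_xsection.
rewrite prodE /product_measure1; apply/andP; split.
  rewrite AE//; apply: ge0_le_integral => //.
    by move=> y _; rewrite mule_ge0// lee_fin// mulr_ge0.
  move=> y _ /=; rewrite indicE.
  have [/set_mem/bound/andP[+ _]|_] := boolP (y \in A).
    by rewrite mul1e.
  by rewrite mul0e.
(* The upper integrand must be nonnegative, and [0 <= hi] can only be read off at a point of [A];
   for empty [A] the probability is 0. *)
have [[y0 Ay0]|A0] := pselect (A !=set0); last first.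
  have {}A0 : A = set0 by apply/seteqP; split => // y Ay; apply: A0; exists y.
  rewrite [leLHS](_ : _ = 0%E).
    by rewrite A0 preimage_set0 measure0 mul0e.
  apply: integral0_eq => y _ /=; rewrite sec0 ?measure0// A0.
  exact.
have hi0 : 0 <= hi.
  have /(H y0) : c - h <= m y0 + (c - m y0) <= c + h by apply/andP; split; lra.
  by move=> /(_ Ay0) /andP[+ +]; lra.
rewrite AE//; apply: ge0_le_integral => //.
move=> y _ /=; rewrite indicE.
have [/set_mem/bound/andP[_ +]|/negP Ay] := boolP (y \in A).
  by rewrite mul1e.
rewrite sec0 ?measure0 ?mul0e// => yA; apply: Ay; exact: mem_set.
Qed.

(** * Independence of one noise variable from the noise on a set of other nodes *)

(** Boxes, unlike cylinders over a single coordinate, are stable under intersection, as uniqueness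
    of measures requires of a generator. *)
Lemma measurable_tuple_boxes (R : realType) (p : nat) :
  (measurable : set (set (p.-tuple R))) =
  <<s [set A | exists2 B : 'I_p -> set R, (forall i, measurable (B i))
      & A = [set t | forall i, B i (tnth t i)]] >>.
Proof.
apply/seteqP; split.
- apply: smallest_sub; first exact: smallest_sigma_algebra.
  move=> A; rewrite -bigcup_seq => -[i _ /= [B mB <-]].
  apply: sub_sigma_algebra.
  exists (fun j => if j == i then B else setT) => [j|]; first by case: ifP.
  apply/seteqP; split => t /=.
    by move=> [_ Bt] j; case: eqP => // ->.
  by move=> /(_ i); rewrite eqxx.
apply: smallest_sub; first exact: sigma_algebra_measurable.
move=> _ [B mB ->].
have -> : [set t : p.-tuple R | forall i, B i (tnth t i)] =
    \bigcap_(i in [set: 'I_p]) ((fun t : p.-tuple R => tnth t i) @^-1` B i).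
  by apply/seteqP; split => t /= Bt i; [move=> _|]; exact: Bt.
apply: fin_bigcap_measurable; first exact: finite_finset.
move=> i _; rewrite -[X in measurable X]setTI.
exact: measurable_tnth.
Qed.

(* For an ancestral set [S], solving the structural equations with the noise
   outside [S] replaced by 0 does not change the coordinates in [S], and the
   modified noise is independent of each remaining noise variable. *)
Definition zero_extension (R : realType) (p : nat) (S : {set 'I_p})
    (x : 'I_p -> R) : p.-tuple R :=
  [tuple if i \in S then x i else 0 | i < p].

Section Independence.
Variables (R : realType) (d : measure_display) (Omega : measurableType d).
Variables (Pr : probability Omega R) (p : nat) (eps : 'I_p -> Omega -> R).
Hypothesis meps : forall i, measurable_fun setT (eps i).
Hypothesis indep : mutually_independent Pr eps.

Lemma measurable_zero_extension (S : {set 'I_p}) :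
  measurable_fun setT (fun w => zero_extension S (eps^~ w)).
Proof.
apply/measurable_fun_tnthP => i.
apply: (@eq_measurable_fun _ _ _ _ _ (fun w => if i \in S then eps i w else 0)).
  by move=> w _ /=; rewrite tnth_mktuple.
by case: (i \in S); [exact: meps|exact: measurable_cst].
Qed.

(** For fixed [B] both sides are finite measures in [A]; mutual independence makes them agree on
    boxes, hence on all measurable sets. *)
Lemma independent_zero_extension (S : {set 'I_p}) (j : 'I_p)
    (A : set (p.-tuple R)) (B : set R) :
  j \notin S -> measurable A -> measurable B ->
  Pr ((fun w => zero_extension S (eps^~ w)) @^-1` A `&` eps j @^-1` B)
  = (Pr ((fun w => zero_extension S (eps^~ w)) @^-1` A) * Pr (eps j @^-1` B))%E.
Proof.
move=> jS mA mB; set Y := fun w => _.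
have mY : measurable_fun setT Y := measurable_zero_extension S.
have mj : measurable (eps j @^-1` B).
  by rewrite -[X in measurable X]setTI; exact: meps.
pose r : {nonneg R} := NngNum (fine_ge0 (measure_ge0 Pr (eps j @^-1` B))).
have rE : (r%:num%:E = Pr (eps j @^-1` B))%E.
  by rewrite /= fineK// fin_num_measure.
pose m1 : {measure set (p.-tuple R) -> \bar R} :=
  pushforward (mrestr Pr mj) Y.
pose m2 : {measure set (p.-tuple R) -> \bar R} :=
  mscale r (pushforward Pr Y).
rewrite muleC -rE; change (m1 mY A = m2 mY A).
apply: (measure_unique _ (fun=> setT) (@measurable_tuple_boxes R p)) => //.
- move=> _ _ [C mC ->] [D mD ->]; exists (fun i => C i `&` D i).
    by move=> i; exact: measurableI.
  apply/seteqP; split => t /= => [[Ct Dt] i|CD]; first by split.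
  by split => i; case: (CD i).
- by move=> _; exists (fun=> setT) => //; apply/seteqP; split.
- by rewrite bigcup_const//; exists 0%N.
- move=> _ [C mC ->].
  (* The box condition is rewritten as one condition per noise variable; for [i] outside [S] it is
     always true or always false. *)
  pose E i : set R := [set u | C i (if i \in S then u else 0)].
  have mE i : measurable (E i).
    rewrite /E; case: (i \in S); first exact: mC.
    have [C0|C0] := pselect (C i 0).
      by rewrite (_ : [set _ | _] = setT)//; apply/seteqP; split.
    by rewrite (_ : [set _ | _] = set0)//; apply/seteqP; split.
  pose EB i := if i == j then E i `&` B else E i.
  have mEB i : measurable (EB i).
    by rewrite /EB; case: eqP => // _; exact: measurableI.
  have YE : Y @^-1` [set t | forall i, C i (tnth t i)]
      = \bigcap_(i in [set: 'I_p]) (eps i @^-1` E i).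
    apply/seteqP; split => w /= H i; last by rewrite tnth_mktuple; exact: H.
    by move=> _; have := H i; rewrite tnth_mktuple.
  have YEB : Y @^-1` [set t | forall i, C i (tnth t i)] `&` eps j @^-1` B
      = \bigcap_(i in [set: 'I_p]) (eps i @^-1` EB i).
    rewrite YE; apply/seteqP; split => w /=.
      move=> [H Bw] i _; rewrite /EB; case: eqP => [->|_]; last exact: H.
      by split => //; exact: H.
    move=> H; split => [i _|]; last by have := H j I; rewrite /EB eqxx => -[].
    by have := H i I; rewrite /EB; case: eqP => // _ [].
  change (Pr (Y @^-1` [set t | forall i, C i (tnth t i)] `&` eps j @^-1` B)
    = r%:num%:E * Pr (Y @^-1` [set t | forall i, C i (tnth t i)]))%E.
  rewrite YEB YE rE !indep// (bigD1 j)//= [in RHS](bigD1 j)//= muleA.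
  congr (_ * _)%E; last first.
    by apply: eq_bigr => i /negbTE ij; rewrite /EB ij.
  rewrite /EB eqxx /E (negbTE jS).
  have [C0|C0] := pselect (C j 0).
    rewrite (_ : [set _ | _] = setT); last by apply/seteqP; split.
    by rewrite setTI preimage_setT probability_setT mule1.
  rewrite (_ : [set _ | _] = set0); last by apply/seteqP; split.
  by rewrite set0I preimage_set0 measure0 mule0.
- move=> _; change (Pr (Y @^-1` setT `&` eps j @^-1` B) < +oo)%E.
  by rewrite preimage_setT setTI -ge0_fin_numE// fin_num_measure.
Qed.

End Independence.

(** * Measurability of the structural equations and their solution *)

Section Measurability.
Variables (R : realType) (p : nat) (M : plsem R p).
Hypothesis wfM : plsem_wf M.

Lemma plsem_f_continuous i j : pl_edge M i j -> continuous (pl_f M j i).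
Proof.
move=> e; have [_ [_ /(_ _ _ e) [[df _] _]]] := wfM.
by move=> x; apply/differentiable_continuous/derivable1_diffP.
Qed.

Lemma measurable_structural d (T : measurableType d) (x : 'I_p -> T -> R) j :
  (forall i, measurable_fun setT (x i)) ->
  measurable_fun setT
    (fun t => pl_mu M j + \sum_(i < p | pl_edge M i j) pl_f M j i (x i t)).
Proof.
move=> mx; apply: measurable_funD; first exact: measurable_cst.
under eq_fun do rewrite big_mkcond/=.
apply: measurable_sum => i.
case: (boolP (pl_edge M i j)) => [e|_]; last exact: measurable_cst.
apply: measurableT_comp (mx i).
by apply: continuous_measurable_fun; exact: plsem_f_continuous.
Qed.

Lemma measurable_plsem_sol j :
  measurable_fun setT (fun t : p.-tuple R => plsem_sol M (tnth t) j).
Proof.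
rewrite /plsem_sol; elim: p.+1 j => [|n IH] j /=; first exact: measurable_cst.
apply: measurable_funD; last exact: measurable_tnth.
exact: measurable_structural.
Qed.

End Measurability.

(** * Box probabilities and the density *)

Definition plsem_residual (R : realType) (p : nat) (M : plsem R p)
    (x : 'I_p -> R) (j : 'I_p) : R :=
  x j - pl_mu M j - \sum_(i < p | pl_edge M i j) pl_f M j i (x i).

(* No Jacobian factor occurs because the residual map is triangular with unit
   diagonal. *)
Definition plsem_density (R : realType) (p : nat) (M : plsem R p)
    (x : 'I_p -> R) : R :=
  \prod_j normal_pdf 0 (pl_sigma M j) (plsem_residual M x j).

Section BoxBound.
Variables (R : realType) (p : nat) (M : plsem R p) (d : measure_display)
  (Omega : measurableType d) (Pr : probability Omega R)
  (eps X : 'I_p -> Omega -> R).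
Hypothesis wfM : plsem_wf M.
Hypothesis meps : forall j, measurable_fun setT (eps j).
Hypothesis law : forall j (B : set R), measurable B ->
  Pr (eps j @^-1` B) = normal_prob 0 (pl_sigma M j) B.
Hypothesis indep : mutually_independent Pr eps.
Hypothesis XE : forall j w, X j w = pl_mu M j
  + \sum_(i < p | pl_edge M i j) pl_f M j i (X i w) + eps j w.
Variables (x : 'I_p -> R) (h : R) (lo hi : 'I_p -> R).
Hypotheses (h0 : 0 <= h) (lo0 : forall j, 0 <= lo j).
Hypothesis bound : forall j y, (forall i, x i - h <= y i <= x i + h) ->
  lo j <= normal_pdf 0 (pl_sigma M j) (plsem_residual M y j) <= hi j.

Let dagM : is_dag (pl_edge M). Proof. by case: wfM. Qed.

(* Induction over ancestral sets, removing a node of maximal rank at each step. *)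
Lemma plsem_box_bound_ancestral (n : nat) (S : {set 'I_p}) : #|S| = n ->
  (forall i j, pl_edge M i j -> j \in S -> i \in S) ->
  ((\prod_(j in S) (h *+ 2 * lo j))%:E
   <= Pr [set w | forall j, j \in S -> (x j - h <= X j w <= x j + h)%R]
   <= (\prod_(j in S) (h *+ 2 * hi j))%:E)%E.
Proof.
have [r rE _] := dag_rank dagM.
elim: n S => [|n IH] S cS anc.
  move/eqP: cS; rewrite cards_eq0 => /eqP ->; rewrite !big_set0.
  rewrite (_ : mkset _ = setT) ?probability_setT ?lexx//.
  by apply/seteqP; split => w //= _ j; rewrite finset.in_set0.
have [j0 j0S] : exists j, j \in S by apply/card_gt0P; rewrite cS.
case: (@arg_maxnP _ j0 (mem S) r j0S) => j jS0 jmax; have jS : j \in S := jS0.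
set S' := S :\ j.
have jS' : j \notin S' by rewrite !inE eqxx.
(* Having maximal rank, [j] has no child in [S], so its removal leaves an ancestral set. *)
have anc' i k : pl_edge M i k -> k \in S' -> i \in S'.
  move=> e; rewrite !inE => /andP[kj kS]; rewrite (anc _ _ e kS) andbT.
  apply/eqP => ij; move: e; rewrite ij => /rE; rewrite ltnNge => /negP; apply.
  exact: jmax.
have paj i : pl_edge M i j -> i \in S'.
  move=> e; rewrite !inE (anc _ _ e jS) andbT; apply/eqP => ij.
  by move: e; rewrite ij plsem_noloop.
pose Y w := zero_extension S' (eps^~ w).
have mY : measurable_fun setT Y := measurable_zero_extension meps S'.
pose A : set (p.-tuple R) := [set t | forall l, l \in S' ->
  x l - h <= plsem_sol M (tnth t) l <= x l + h].
pose m (t : p.-tuple R) := pl_mu M j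
  + \sum_(i < p | pl_edge M i j) pl_f M j i (plsem_sol M (tnth t) i).
have mA : measurable A.
  rewrite (_ : A = \bigcap_(l in [set l | l \in S'])
      ((fun t => plsem_sol M (tnth t) l) @^-1` `[x l - h, x l + h]%classic)).
    apply: fin_bigcap_measurable; first exact: finite_finset.
    move=> l _; rewrite -[X in measurable X]setTI.
    by apply: (measurable_plsem_sol wfM) => //; exact: measurable_itv.
  by apply/seteqP; split => t /= H l lS; have := H l lS; rewrite /= in_itv.
have mm : measurable_fun setT m.
  by apply: (measurable_structural wfM) => i; exact: measurable_plsem_sol.
have solY w l : l \in S' -> X l w = plsem_sol M (tnth (Y w)) l.
  apply: (@plsem_sol_unique _ _ M dagM S' (tnth (Y w)) (X^~ w)) => // k kS.
  by rewrite tnth_mktuple kS; exact: XE.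
have XjE w : X j w = m (Y w) + eps j w.
  rewrite XE; congr (_ + _ + _); apply: eq_bigr => i e.
  by rewrite solY// paj.
have evE' : [set w | forall l, l \in S' -> x l - h <= X l w <= x l + h]
    = Y @^-1` A.
  apply/seteqP; split => w /= H l lS; first by rewrite -solY//; exact: H.
  by rewrite solY//; exact: H.
have evE : [set w | forall l, l \in S -> x l - h <= X l w <= x l + h]
    = [set w | A (Y w) /\ x j - h <= m (Y w) + eps j w <= x j + h].
  apply/seteqP; split => w /=.
    move=> H; split; last by rewrite -XjE; exact: H.
    have : (Y @^-1` A) w; last by [].
    by rewrite -evE' => l /=; rewrite !inE => /andP[_]; exact: H.
  rewrite -XjE => -[AY Hj] l lS; have [->//|lj] := eqVneq l j.
  have : (Y @^-1` A) w by [].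
  by rewrite -evE'; apply; rewrite !inE lj.
have step := @normal_conditional_bound _ _ _ _ _ Pr Y (eps j) (pl_sigma M j) m A
  (x j) h (lo j) (hi j) mY (meps j) (law j)
  (fun C B => @independent_zero_extension _ _ _ Pr _ eps meps indep S' j C B jS')
  mm mA h0 (lo0 j).
have h20 : 0 <= h *+ 2 by rewrite mulrn_wge0.
have hi0 : 0 <= hi j.
  have /(bound j)/andP[l1 l2] : forall i, x i - h <= x i <= x i + h.
    by move=> i; apply/andP; split; lra.
  exact: le_trans (le_trans (lo0 j) l1) l2.
have /andP[IHl IHu] : ((\prod_(j in S') (h *+ 2 * lo j))%:E
   <= Pr (Y @^-1` A) <= (\prod_(j in S') (h *+ 2 * hi j))%:E)%E.
  rewrite -evE'; apply: IH => //.
  by move: cS; rewrite (cardsD1 j) jS add1n => -[].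
have prodE (f : 'I_p -> R) :
    \prod_(i in S) f i = (\prod_(i in S') f i) * f j.
  by rewrite mulrC; exact: big_setD1.
rewrite !prodE !EFinM evE.
have /andP[sl su] : (Pr (Y @^-1` A) * (h *+ 2 * lo j)%:E
     <= Pr [set w | A (Y w) /\ (x j - h <= m (Y w) + eps j w <= x j + h)%R]
     <= Pr (Y @^-1` A) * (h *+ 2 * hi j)%:E)%E.
  apply: step => y u Ay mu.
  (* A point of the box whose residual at [j] is [u]; coordinates outside [S] are put at the
     centre. *)
  pose z i := if i \in S' then plsem_sol M (tnth y) i
    else if i == j then m y + u else x i.
  have -> : u = plsem_residual M z j.
    rewrite /plsem_residual {1}/z (negbTE jS') eqxx.
    rewrite (eq_bigr (fun i => pl_f M j i (plsem_sol M (tnth y) i))).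
      by rewrite /m; ring.
    by move=> i /paj iS; rewrite /z iS.
  apply: bound => i; rewrite /z; case: ifP => [iS|_]; first exact: Ay.
  case: eqP => [->//|_].
  by apply/andP; split; lra.
apply/andP; split.
  by apply: le_trans sl; rewrite lee_wpmul2r// lee_fin mulr_ge0.
by apply: (le_trans su); rewrite lee_wpmul2r// lee_fin mulr_ge0.
Qed.

End BoxBound.

Lemma plsem_box_bound (R : realType) (p : nat) (M : plsem R p)
    (P : probability (p.-tuple R) R) (x : 'I_p -> R) (h : R)
    (lo hi : 'I_p -> R) :
  generates M P -> 0 <= h -> (forall j, 0 <= lo j) ->
  (forall j y, (forall i, x i - h <= y i <= x i + h) ->
    lo j <= normal_pdf 0 (pl_sigma M j) (plsem_residual M y j) <= hi j) ->
  ((\prod_j (h *+ 2 * lo j))%:E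
   <= P [set t | forall j, (x j - h <= tnth t j <= x j + h)%R]
   <= (\prod_j (h *+ 2 * hi j))%:E)%E.
Proof.
move=> [wfM [d [T [Pr [eps [X [meps [law [indep [mX [XE [_ PE]]]]]]]]]]]].
move=> h0 lo0 bound.
have := plsem_box_bound_ancestral wfM meps law indep XE h0 lo0 bound
  (erefl #|[set: 'I_p]%SET|) (fun i j _ _ => finset.in_setT i).
under eq_bigl do rewrite finset.in_setT.
under [X in (_ <= _ <= X%:E)%E -> _]eq_bigl do rewrite finset.in_setT.
rewrite PE.
  rewrite (_ : mkset _ = (fun w => [tuple X i w | i < p]) @^-1`
    [set t | forall j, (x j - h <= tnth t j <= x j + h)%R])//.
  apply/seteqP; split => w /= H j.
    by rewrite tnth_mktuple; exact: H (finset.in_setT j).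
  by move=> _; have := H j; rewrite tnth_mktuple.
rewrite (_ : mkset _ = \bigcap_(l in [set: 'I_p])
    ((fun t : p.-tuple R => tnth t l) @^-1` `[x l - h, x l + h]%classic)).
  apply: fin_bigcap_measurable; first exact: finite_finset.
  move=> l _; rewrite -[X in measurable X]setTI.
  by apply: measurable_tnth => //; exact: measurable_itv.
by apply/seteqP; split => t /= H l; [move=> _|]; have := H l; rewrite /= in_itv/=; exact.
Qed.

Lemma normal_pdf_gt0 (R : realType) (s u : R) : s != 0 -> 0 < normal_pdf 0 s u.
Proof.
by move=> s0; rewrite normal_pdfE// mulr_gt0 ?normal_peak_gt0// expR_gt0.
Qed.

(** * Comparison of the densities of two models of the same distribution *)

Section Density.
Variables (R : realType) (p : nat).
Implicit Type M : plsem R p.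

(** The factors are continuous and positive, so their error near [x] can be made relative; such
    errors pass through the product over [j]. *)
Lemma plsem_density_near M (x : 'cV[R]_p) (eta : R) : plsem_wf M -> 0 < eta ->
  \forall y \near x, forall j,
    let a := normal_pdf 0 (pl_sigma M j) (plsem_residual M (x^~ 0) j) in
    a * (1 - eta)
      <= normal_pdf 0 (pl_sigma M j) (plsem_residual M ((y : 'cV[R]_p)^~ 0) j)
      <= a * (1 + eta).
Proof.
move=> wfM eta0; have [_ [sigma_gt0 _]] := wfM.
pose g j (y : 'cV[R]_p) :=
  normal_pdf 0 (pl_sigma M j) (plsem_residual M (y^~ 0) j).
suff H j : \forall y \near x,
    g j x * (1 - eta) <= g j y <= g j x * (1 + eta).
  have := @filter_forall _ _ (fun j (y : 'cV[R]_p) =>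
    g j x * (1 - eta) <= g j y <= g j x * (1 + eta)) (nbhs x) _ H.
  by move=> /(_ (nbhs_filter x)); apply: filterS => y Hy j; exact: Hy.
have s0 : pl_sigma M j != 0 by exact: lt0r_neq0.
have a0 : 0 < g j x by exact: normal_pdf_gt0.
have cont : g j y @[y --> x] --> g j x.
  apply: (@continuous_comp _ _ _ (fun y : 'cV[R]_p =>
    plsem_residual M (y^~ 0) j)); last exact: continuous_normal_pdf.
  rewrite /plsem_residual; apply: cvgB; first exact: (nbhs_filter x).
    apply: cvgB; [exact: (nbhs_filter x)|exact: coord_continuous|].
    by apply: cvg_cst; exact: (nbhs_filter x).
  apply: cvg_big => [||i e].
  - exact: add_continuous.
  - exact: (nbhs_filter x).
  apply: (@continuous_comp _ _ _ (fun y : 'cV[R]_p => y i 0) (pl_f M j i)).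
    exact: coord_continuous.
  exact: (plsem_f_continuous wfM e).
have ae : 0 < g j x * eta by exact: mulr_gt0.
have /cvgrPdist_lt/(_ _ ae) := cont.
apply: (@filterS _ _ (nbhs_filter x)) => y.
rewrite ltr_norml mulrBr mulrDr mulr1 => /andP[? ?].
by apply/andP; split; lra.
Qed.

(** The probability of one small box is at least the lower bound from [M] and at most the upper
    bound from [N]. The volume of the box cancels, and [eta] tends to 0. *)
Lemma plsem_density_le M N (P : probability (p.-tuple R) R) (x : 'I_p -> R) :
  generates M P -> generates N P -> plsem_density M x <= plsem_density N x.
Proof.
move=> gM gN; have [wM _] := gM; have [wN _] := gN.
pose a j := normal_pdf 0 (pl_sigma M j) (plsem_residual M x j).
pose b j := normal_pdf 0 (pl_sigma N j) (plsem_residual N x j).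
have cvg1 (c : 'I_p -> R) (k : R) :
    \prod_j (c j * (1 + k * eta)) @[eta --> 0^'+] --> \prod_j c j.
  apply: cvg_big => [|j _]; first exact: mul_continuous.
  rewrite -[X in _ --> X]mulr1; apply: cvgMr.
  rewrite -[X in _ --> X]addr0; apply: cvgD; first exact: cvg_cst.
  rewrite -[X in _ --> X](mulr0 k); apply: cvgMr.
  exact: cvg_at_right_filter cvg_id.
apply: (ler_cvg_to (cvg1 a (-1)) (cvg1 b 1)).
near=> eta.
have eta0 : 0 < eta by [].
have eta1 : eta < 1 by near: eta; exact: nbhs_right_lt.
pose x' : 'cV[R]_p := \col_j x j.
have x'E : x'^~ 0 = x by apply/funext => j; rewrite mxE.
have /nbhs_ballP[e /= e0 eP] := @filterI _ _ (nbhs_filter x') _ _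
  (plsem_density_near x' wM eta0) (plsem_density_near x' wN eta0).
(* Half the radius is taken so that the closed box lies in the open ball. *)
have inball (y : 'I_p -> R) : (forall i, x i - e / 2 <= y i <= x i + e / 2) ->
    ball x' e (\col_j y j).
  move=> H; split => // i k; rewrite !mxE /ball/= /ball_/= ltr_norml.
  by have /andP[? ?] := H i; apply/andP; split; lra.
have colE (y : 'I_p -> R) : (\col_j y j : 'cV[R]_p)^~ 0 = y.
  by apply/funext => j; rewrite mxE.
have e20 : 0 <= e / 2 by rewrite divr_ge0// ltW.
have := @plsem_box_bound _ _ M P x (e / 2) (fun j => a j * (1 - eta))
  (fun j => a j * (1 + eta)) gM e20.
have := @plsem_box_bound _ _ N P x (e / 2) (fun j => b j * (1 - eta))
  (fun j => b j * (1 + eta)) gN e20.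
move=> /(_ _ _)/andP[].
- by move=> j; rewrite mulr_ge0 ?normal_pdf_ge0// subr_ge0 ltW.
- move=> j y /inball/eP[_ /(_ j)]; rewrite x'E colE; exact.
move=> _ uN /(_ _ _)/andP[].
- by move=> j; rewrite mulr_ge0 ?normal_pdf_ge0// subr_ge0 ltW.
- move=> j y /inball/eP[/(_ j) + _]; rewrite x'E colE; exact.
move=> lM _; have := le_trans lM uN; rewrite lee_fin !big_split/=.
have h0 : 0 < \prod_(i < p) (e / 2 *+ 2).
  by apply: prodr_gt0 => i _; rewrite mulrn_wgt0// divr_gt0.
by rewrite ler_pM2l// -!big_split/= mulN1r mul1r.
Unshelve. all: by end_near.
Qed.

Lemma plsem_densityE M (x : 'cV[R]_p) : plsem_wf M ->
  plsem_density M (x^~ 0) = \prod_j normal_peak (pl_sigma M j)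
    * expR (- (\sum_j plsem_fun M x j 0 ^+ 2) / 2).
Proof.
move=> [_ [sigma_gt0 _]].
rewrite mulNr mulr_suml -sumrN expR_sum -big_split; apply: eq_bigr => j _ /=.
have s0 : pl_sigma M j != 0 by exact: lt0r_neq0.
rewrite normal_pdfE// /normal_fun subr0 mxE -/(plsem_residual M (x^~ 0) j).
by congr (_ * expR _); field.
Qed.

Lemma plsem_fun_norm_eq M N (P : probability (p.-tuple R) R) (x : 'cV[R]_p) :
  generates M P -> generates N P ->
  \sum_j plsem_fun M x j 0 ^+ 2 = \sum_j plsem_fun N x j 0 ^+ 2.
Proof.
move=> gM gN; have [wM _] := gM; have [wN _] := gN.
pose K L := \prod_j normal_peak (pl_sigma (L : plsem R p) j).
pose E (L : plsem R p) y := expR (- (\sum_j plsem_fun L y j 0 ^+ 2) / 2).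
have dE y : K M * E M y = K N * E N y.
  rewrite /K /E -!plsem_densityE//; apply/eqP; rewrite eq_le.
  by rewrite (plsem_density_le _ gM gN) (plsem_density_le _ gN gM).
have K0 L : plsem_wf L -> 0 < K L.
  move=> [_ [s0 _]]; apply: prodr_gt0 => j _.
  by rewrite normal_peak_gt0// lt0r_neq0.
have E1 L y : E L y <= 1.
  rewrite /E -expR0 ler_expR mulNr oppr_le0 divr_ge0// sumr_ge0// => j _.
  exact: sqr_ge0.
(* At a zero of the function of [L] its exponential is 1, while that of [L'] is at most 1. By
   symmetry the normalizing constants coincide. *)
have Kle L L' : plsem_wf L -> plsem_wf L' ->
    (forall y, K L * E L y = K L' * E L' y) -> K L <= K L'.
  move=> wL wL' LL'; have [a La] := plsem_fun_zero wL.
  have E0 : E L (\col_k a k) = 1.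
    rewrite /E La big1 ?oppr0 ?mul0r ?expR0// => j _.
    by rewrite mxE expr0n.
  by rewrite -[leLHS]mulr1 -E0 LL' ler_piMr// ltW// K0.
have KMN : K M = K N by apply/le_anti; rewrite !Kle.
have := dE x; rewrite KMN => /(mulfI (lt0r_neq0 (K0 _ wN)))/expR_inj.
by move=> e; lra.
Qed.

End Density.

Theorem mainTheorem3 (R : realType) (p : nat)
  (P : probability (p.-tuple R) R) (F : 'cV[R]_p -> 'cV[R]_p) :
  (exists M : plsem R p, generates M P) ->
  plsem_funs P F ->
  exists Os : set 'M[R]_p,
    Os `<=` [set O | O *m O^T = 1%:M] /\
    plsem_funs P = [set G | exists2 O, Os O & G = (fun x => O *m F x)].
Proof.
move=> _ [M [gM FE]].
(* Taking all orthogonal matrices that send [F] to a PLSEM-function of [P] makes one inclusion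
   immediate; the other is [plsem_fun_orthogonal]. *)
exists [set Q | Q *m Q^T = 1%:M /\ plsem_funs P (fun x => Q *m F x)].
split; first by move=> Q [].
apply/seteqP; split => [G [N [gN GE]]|G [Q [_ QP] ->]//].
have [wM _] := gM; have [wN _] := gN.
have [Q QQ NE] := plsem_fun_orthogonal wM wN
  (fun x => plsem_fun_norm_eq x gM gN).
have GQ : G = (fun x => Q *m F x) by rewrite GE FE.
exists Q => //; split => //; rewrite -GQ.
by exists N.
Qed.
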